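(* Let $q=p^l$ be a prime power ($p$ prime) and $\mathbb{F}_q$ the finite field of order $q$. Let $\mathcal{D}$ be a $1$-$(v,k,r)$ design with blocks $B_1,\ldots,B_b$ and let $a\in\mathbb{F}_p$, $a\neq 0$, be such that $k\equiv a\pmod p$ and $|B_i\cap B_j|\equiv 0\pmod p$ for all $i,j\in\{1,\ldots,b\}$, $i\neq j$. Let $G$ be an automorphism group of $\mathcal{D}$ which acts on $\mathcal{D}$ with $f_1$ fixed points and $n$ point orbits of length $p^\alpha$, $1\leq\alpha\leq l$, and with $f_2$ fixed blocks and $m$ block orbits of length $p^\alpha$ (and no other orbits). Let $OM1$ and $OM2$ be, respectively, the submatrix of the orbit matrix indexed by fixed blocks and fixed points, and the submatrix indexed by block orbits and point orbits of length $p^\alpha$. Let $\mathbb{F}=\mathbb{F}_q$ if $-a$ is a square in $\mathbb{F}_q$, and $\mathbb{F}=\mathbb{F}_{q^2}$ otherwise. Then: 1. the linear code spanned by the rows of the matrix $[\sqrt{-a}\cdot I_{f_2},\ OM1]$ is a self-orthogonal $[f_2+f_1,f_2]$ code over the field $\mathbb{F}$; 2. the linear code spanned by the rows of the matrix $[\sqrt{-a}\cdot I_m,\ OM2]$ is a self-orthogonal $[m+n,m]$ code over the field $\mathbb{F}$. If $m=n$, the obtained code is self-dual.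
   Context: A $1$-$(v,k,r)$ design is a finite incidence structure with $v$ points and $b$ blocks such that every block is incident with exactly $k$ points and every point is incident with exactly $r$ blocks. For blocks $B_i,B_j$, $|B_i\cap B_j|$ is the number of points incident with both. An automorphism group of $\mathcal{D}$ is a group of incidence-preserving bijections (points to points, blocks to blocks) of $\mathcal{D}$. The orbit matrix under $G$ has rows indexed by block orbits $\mathcal{B}_i$ and columns by point orbits $\mathcal{V}_j$, with entry $a_{i,j}$ equal to the number of points of $\mathcal{V}_j$ incident with a block of $\mathcal{B}_i$ (independent of the chosen block). Order the orbits so that fixed points (columns $1,\ldots,f_1$) and fixed blocks (rows $1,\ldots,f_2$) come first. Then $OM1=[a_{i,j}]_{1\le i\le f_2,\,1\le j\le f_1}$ and $OM2=[a_{f_2+i,f_1+j}]_{1\le i\le m,\,1\le j\le n}$, with entries viewed in the field under consideration. $I_N$ is the identity matrix and $[X,Y]$ denotes horizontal concatenation. For $c\in\mathbb{F}_p$, viewed in $\mathbb{F}$, $\sqrt{c}$ denotes an element of $\mathbb{F}$ whose square is $c$. An $[N,K]$ code has length $N$ and dimension $K$. A code $C\subseteq\mathbb{F}^N$ is self-orthogonal if $C\subseteq C^\perp$ and self-dual if $C=C^\perp$, where $C^\perp$ is the dual under the standard (bilinear) inner product. *)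

(* Defs.v *)
From HB Require Import structures.
From mathcomp Require Import all_boot all_order all_fingroup all_algebra.

Set Implicit Arguments.
Unset Strict Implicit.
Unset Printing Implicit Defensive.

Import GRing.Theory GroupScope.

(** An incidence structure is a relation [inc x B]
    ("the point [x] is incident with the block [B]") between two finite types;
    distinct blocks may be incident with the same points. *)

Section Designs.
Variables (point block : finType) (inc : point -> block -> bool).

Definition points_on (B : block) : {set point} := [set x | inc x B].
Definition blocks_through (x : point) : {set block} := [set B | inc x B].

Definition is_1_design (v k r : nat) : Prop :=
  [/\ #|point| = v,
      forall B : block, #|points_on B| = k
    & forall x : point, #|blocks_through x| = r].

Definition design_aut : {set {perm point} * {perm block}} :=
  [set g : {perm point} * {perm block} |
     [forall x, forall B, inc (g.1 x) (g.2 B) == inc x B]].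

(** [r x c] orbit matrix for given lists of block orbits and point orbits.
    The entry is computed from an arbitrary block of the orbit [BO i]; see
    [orbit_matrixE] for its independence of this choice.  The default value
    [0] is never used when [BO i] is an orbit. *)
Definition orbit_matrix (r c : nat) (BO : 'I_r -> {set block})
    (VO : 'I_c -> {set point}) : 'M[nat]_(r, c) :=
  \matrix_(i, j) (if [pick B in BO i] is Some B
                  then #|VO j :&: points_on B| else 0%N).

End Designs.

Section Orbits.
Variables (T : finType) (H : {group {perm T}}).

Definition orbit_set : {set {set T}} := orbit 'P H @: [set: T].

(** [f] fixed elements, [n] orbits of length [len], and no other orbits. *)
Definition orbit_type (f n len : nat) : Prop :=
  [/\ #|'Fix_'P(H)| = f,
      #|[set O in orbit_set | #|O| == len]| = n
    & forall O, O \in orbit_set -> #|O| = 1%N \/ #|O| = len].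

Definition orbit_ordering (f n : nat) (O : 'I_(f + n) -> {set T}) : Prop :=
  [/\ injective O,
      O @: [set: 'I_(f + n)] = orbit_set
    & forall j, (#|O j| == 1%N) = (j < f)].

End Orbits.

Lemma orbit_matrixE (point block : finType) (inc : point -> block -> bool)
    (G : {group {perm point} * {perm block}}) (r c : nat)
    (BO : 'I_r -> {set block}) (VO : 'I_c -> {set point}) :
  G \subset design_aut inc ->
  (forall i, BO i \in orbit_set (snd @* G)%G) ->
  (forall j, VO j \in orbit_set (fst @* G)%G) ->
  forall i j B, B \in BO i ->
    orbit_matrix inc BO VO i j = #|VO j :&: points_on inc B|.
Proof.
move=> autG BOP VOP i j B BB; rewrite mxE; case: pickP => [B' BB'|/(_ B)]; last first.
  by rewrite BB.
have [B0 _ defB] := imsetP (BOP i).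
have [x0 _ defV] := imsetP (VOP j).
have : B' \in orbit 'P (snd @* G) B.
  move: BB BB'; rewrite defB => BB BB'.
  by rewrite (orbit_eqP BB).
case/orbitP=> _ /morphimP[g _ Gg ->] /= defB'.
have autg x : inc (g.1 x) B' = inc x B.
  have:= subsetP autG g Gg; rewrite inE => /forallP/(_ x)/forallP/(_ B)/eqP <-.
  by rewrite -defB'.
have G1 : g.1 \in fst @* G by apply: mem_morphim; rewrite ?inE.
have Vg x : (g.1 x \in VO j) = (x \in VO j).
  have /orbit_eqP E : g.1 x \in orbit 'P (fst @* G)%G x.
    exact: (mem_orbit 'P x G1).
  by rewrite defV ![_ \in orbit _ _ x0]orbit_sym E.
rewrite -[RHS](card_imset _ (@perm_inj _ g.1)); apply: eq_card => x.
rewrite -[x in LHS](permKV g.1) -[x in RHS](permKV g.1) mem_imset; last exact: perm_inj.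
by rewrite !inE Vg autg.
Qed.

Section Codes.
Local Open Scope ring_scope.

(** The image of [a] under the embedding of ['F_p] in a field of
    characteristic [p]. *)
Definition Fp_in (F : finFieldType) (p : nat) (a : 'F_p) : F :=
  (nat_of_ord a)%:R.

Variable F : finFieldType.

Definition row_code (K N : nat) (M : 'M[F]_(K, N)) : {vspace 'rV[F]_N} :=
  <<[seq row i M | i : 'I_K]>>%VS.

Definition dotp (N : nat) (x y : 'rV[F]_N) : F := \sum_i x 0 i * y 0 i.

Definition dual_code (N : nat) (C : {vspace 'rV[F]_N}) : {set 'rV[F]_N} :=
  [set y | [forall x, (x \in C) ==> (dotp x y == 0)]].

Definition self_orthogonal (N : nat) (C : {vspace 'rV[F]_N}) : Prop :=
  {subset C <= dual_code C}.

Definition self_dual (N : nat) (C : {vspace 'rV[F]_N}) : Prop :=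
  C =i dual_code C.

(** [[c I_K, M]], with the entries of [M] viewed in [F]. *)
Definition bordered_mx (K N : nat) (c : F) (M : 'M[nat]_(K, N)) :
    'M[F]_(K, K + N) :=
  row_mx c%:M (map_mx (fun x : nat => x%:R) M).

End Codes.

(* Main.v *)
Require Import Defs.
From mathcomp Require Import all_boot all_order all_fingroup all_algebra.
From mathcomp Require Import all_solvable all_field.
From mathcomp Require Import zify.

Set Implicit Arguments.
Unset Strict Implicit.
Unset Printing Implicit Defensive.

Import GRing.Theory.

(** Write [A] for the orbit matrix.  Fix blocks [b1], [b2] in the block orbits
    [B1], [B2] and count the pairs [(x, c)] with [c] in [B2] and [x] incident
    with both [b1] and [c].  Grouped by [c], the count is the sum of
    [|b1 :&: c|] over [c] in [B2]; modulo [p] it is [k] if [B1 = B2] (the only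
    surviving term is [c = b1]) and [0] otherwise ([sum_meet_mod]).  Grouped by
    the point orbit [V] of [x], each [V] contributes [A B1 V * d], where [d] is
    the number of blocks of [B2] through a point of [V]; counting flags between
    [V] and [B2] gives [|V| * d = |B2| * A B2 V] ([orbit_flags]).

    Let [|B1| = |B2|].  If [|V| = |B2|], then [d = A B2 V] and the contribution
    is [A B1 V * A B2 V].  If [|V| <> |B2|], one of the two lengths is [1] and
    the other a positive power of [p]: either [d] is [|B2|] times an integer,
    or, by the same flag count for [B1], [A B1 V] is [|V|] times an integer, so
    the contribution vanishes modulo [p].  Hence [OM1] and [OM2] both satisfy
    [M *m M^T = k%:M = a%:M] in characteristic [p] ([orbit_matrix_gram]), and
    the rows of [[s I, M]] with [s ^+ 2 = - a] are pairwise orthogonal,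
    themselves included.  They are independent because [s != 0].  When [M] is
    square, [M *m M^T = a%:M] with [a != 0] implies [M^T *m M = a%:M], which
    says that every vector orthogonal to the rows is the combination of them
    read off from its left half ([self_dual_bordered]).

    The square root of [- a] exists by Euler's criterion.  It asks for an
    equality [c ^+ e = 1] between images of integers, so over fields of equal
    order it has the same truth value; over a field of order [q ^ 2] the
    exponent is a multiple of [q - 1], and [c ^+ q = c] when [c] lies in the
    prime field. *)

(** * Flags between a point orbit and a block orbit *)

Lemma orbit_setP (T : finType) (H : {group {perm T}}) (O : {set T}) x :
  O \in orbit_set H -> x \in O -> O = orbit 'P H x.
Proof. by case/imsetP=> y _ -> /orbit_eqP ->. Qed.

Lemma orbit_set_eq (T : finType) (H : {group {perm T}}) (O1 O2 : {set T}) x :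
  O1 \in orbit_set H -> O2 \in orbit_set H -> x \in O1 -> x \in O2 -> O1 = O2.
Proof. by move=> H1 H2 /(orbit_setP H1) -> /(orbit_setP H2) ->. Qed.

Lemma big_orbit_ordering (T : finType) (H : {group {perm T}}) c
    (O : 'I_c -> {set T}) (f : T -> nat) :
  injective O -> O @: [set: 'I_c] = orbit_set H ->
  \sum_x f x = \sum_j \sum_(x in O j) f x.
Proof.
move=> injO defO.
have partO : partition (orbit_set H) [set: T].
  by apply: orbit_partition; apply/actsP=> h _ x; rewrite !inE.
transitivity (\sum_(x in [set: T]) f x).
  by apply: eq_bigl => x; rewrite inE.
rewrite (set_partition_big _ partO) -defO big_imset /=; last first.
  by move=> ? ? _ _; exact: injO.
by apply: eq_bigl => j; rewrite inE.
Qed.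

(** Both sides count the incident pairs in [S] x [P]. *)
Lemma sum_points_through (point block : finType)
    (inc : point -> block -> bool) (S : {set point})
    (P : {set block}) :
  \sum_(x in S) #|P :&: blocks_through inc x|
  = \sum_(b in P) #|S :&: points_on inc b|.
Proof.
transitivity (\sum_(x in S) \sum_(b in P) inc x b).
  apply: eq_bigr => x _; rewrite -sum1_card big_mkcond [RHS]big_mkcond.
  by apply: eq_bigr => b _; rewrite !inE; case: (_ \in P); case: inc.
rewrite exchange_big; apply: eq_bigr => b _.
rewrite -sum1_card big_mkcond [RHS]big_mkcond.
by apply: eq_bigr => x _; rewrite !inE; case: (_ \in S); case: inc.
Qed.

Section OrbitCounting.

Variables (point block : finType) (inc : point -> block -> bool).
Variable G : {group {perm point} * {perm block}}.
Hypothesis autG : G \subset design_aut inc.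

Variables (V : {set point}) (B : {set block}).
Hypothesis orbV : V \in orbit_set (fst @* G)%G.
Hypothesis orbB : B \in orbit_set (snd @* G)%G.

Lemma card_orbit_blocks_through x y :
  x \in V -> y \in V ->
  #|B :&: blocks_through inc x| = #|B :&: blocks_through inc y|.
Proof.
move=> xV; rewrite (orbit_setP orbV xV).
move=> /orbitP[_ /morphimP[g _ Gg ->] /= <-].
have autg b : inc (g.1 x) (g.2 b) = inc x b.
  by have:= subsetP autG g Gg; rewrite inE => /forallP/(_ x)/forallP/(_ b)/eqP.
have G2 : g.2 \in (snd @* G)%g by apply: mem_morphim; rewrite ?inE.
have Bg b : (g.2 b \in B) = (b \in B).
  have /orbit_eqP E : g.2 b \in orbit 'P (snd @* G)%G b.
    exact: (mem_orbit 'P b G2).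
  have [b0 _ ->] := imsetP orbB.
  by rewrite ![_ \in orbit _ _ b0]orbit_sym E.
rewrite -(card_imset _ (@perm_inj _ g.2)); apply: eq_card => b.
rewrite -[b](permKV g.2) mem_imset; last exact: perm_inj.
by rewrite !inE Bg /= /aperm autg.
Qed.

Lemma card_orbit_points_on b c :
  b \in B -> c \in B ->
  #|V :&: points_on inc b| = #|V :&: points_on inc c|.
Proof.
pose BO := fun _ : 'I_1 => B; pose VO := fun _ : 'I_1 => V.
have E := @orbit_matrixE _ _ inc G 1 1 BO VO autG
  (fun=> orbB) (fun=> orbV) ord0 ord0.
by move=> /E <- /E <-.
Qed.

(** Both sides count the incident pairs in [V] x [B], where the number of
    incidences is constant on [V] and on [B]. *)
Lemma orbit_flags x b : x \in V -> b \in B ->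
  (#|V| * #|B :&: blocks_through inc x| = #|B| * #|V :&: points_on inc b|)%N.
Proof.
move=> xV bB; rewrite -!sum_nat_const.
rewrite (eq_bigr _ (fun y yV => card_orbit_blocks_through xV yV)).
rewrite (eq_bigr _ (fun c cB => card_orbit_points_on bB cB)).
exact: sum_points_through.
Qed.

End OrbitCounting.

(** * The Gram matrix of an orbit matrix *)

Section Gram.

Variables (point block : finType) (inc : point -> block -> bool).
Variable G : {group {perm point} * {perm block}}.
Hypothesis autG : G \subset design_aut inc.
Variables (p w k : nat).
Hypothesis dvd_pw : p %| w.
Hypothesis block_size : forall b, #|points_on inc b| = k.
Hypothesis meet_mod_p : forall B1 B2 : block, B1 != B2 ->
     #|points_on inc B1 :&: points_on inc B2| = 0 %[mod p].

Section Column.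
Variables (V : {set point}) (B1 B2 : {set block}) (b1 b2 : block).
Hypothesis orbV : V \in orbit_set (fst @* G)%G.
Hypotheses (orbB1 : B1 \in orbit_set (snd @* G)%G) (b1B : b1 \in B1).
Hypotheses (orbB2 : B2 \in orbit_set (snd @* G)%G) (b2B : b2 \in B2).

Lemma column_flags x : x \in V ->
  \sum_(y in V :&: points_on inc b1) #|B2 :&: blocks_through inc y|
  = (#|V :&: points_on inc b1| * #|B2 :&: blocks_through inc x|)%N.
Proof.
move=> xV; rewrite -sum_nat_const; apply: eq_bigr => y /setIP[yV _].
exact: (card_orbit_blocks_through autG orbV orbB2 yV xV).
Qed.

(** The equality of lengths cancels in [orbit_flags], so the number of blocks of
    [B2] through a point of [V] is itself an orbit matrix entry. *)
Lemma column_flags_eq : #|V| = #|B2| ->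
  \sum_(y in V :&: points_on inc b1) #|B2 :&: blocks_through inc y|
  = (#|V :&: points_on inc b1| * #|V :&: points_on inc b2|)%N.
Proof.
move=> eqVB; have [x _ defV] := imsetP orbV.
have xV : x \in V by rewrite defV orbit_refl.
rewrite (column_flags xV); congr (_ * _)%N; apply/eqP.
have V_gt0 : (0 < #|V|)%N by apply/card_gt0P; exists x.
by rewrite -(eqn_pmul2l V_gt0) (orbit_flags autG orbV orbB2 xV b2B) eqVB.
Qed.

(** One of the lengths is [1] and the other [w].  If [V] is a fixed point, all
    or no blocks of [B2] pass through it; if the blocks are fixed, they contain
    all or none of [V].  In both cases a factor [w] appears. *)
Lemma column_flags_neq : #|B1| = #|B2| -> #|V| != #|B2| ->
  (#|V| = 1 \/ #|V| = w)%N -> (#|B2| = 1 \/ #|B2| = w)%N ->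
  p %| \sum_(y in V :&: points_on inc b1) #|B2 :&: blocks_through inc y|.
Proof.
move=> eqB neqVB cV cB; have [x _ defV] := imsetP orbV.
have xV : x \in V by rewrite defV orbit_refl.
rewrite (column_flags xV).
have f1 := orbit_flags autG orbV orbB1 xV b1B.
have f2 := orbit_flags autG orbV orbB2 xV b2B.
case: cV cB neqVB f1 f2 => -> [] e2; rewrite eqB e2 ?eqxx // => _.
  by move=> _; rewrite mul1n => ->; rewrite dvdn_mull // dvdn_mulr.
by rewrite mul1n => <- _; rewrite -mulnA dvdn_mulr.
Qed.

End Column.

Lemma sum_meet_mod (b : block) (B : {set block}) :
  \sum_(c in B) #|points_on inc b :&: points_on inc c|
  = (b \in B) * k %[mod p].
Proof.
have off : \sum_(c in B | c != b)
    #|points_on inc b :&: points_on inc c| = 0 %[mod p].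
  apply/eqP; rewrite mod0n; apply: dvdn_sum => c /andP[_ cb].
  by apply/eqP; rewrite meet_mod_p ?mod0n // eq_sym.
case: (boolP (b \in B)) => bB; last first.
  rewrite mul0n -off; congr (_ %% _)%N; apply: eq_bigl => c.
  by case: eqP => [->|]; rewrite ?andbT ?(negPf bB).
rewrite (bigD1 b bB) /= setIid block_size mul1n -modnDmr.
by rewrite off mod0n addn0.
Qed.

Variables (r c : nat) (BO : 'I_r -> {set block}) (VO : 'I_c -> {set point}).
Hypothesis injV : injective VO.
Hypothesis defV : VO @: [set: 'I_c] = orbit_set (fst @* G)%G.
Hypothesis injB : injective BO.
Hypothesis defB : BO @: [set: 'I_r] = orbit_set (snd @* G)%G.
Hypothesis lenV : forall O, O \in orbit_set (fst @* G)%G ->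
  (#|O| = 1 \/ #|O| = w)%N.
Hypothesis lenB : forall O, O \in orbit_set (snd @* G)%G ->
  (#|O| = 1 \/ #|O| = w)%N.

(** Modulo [p], the columns of length [L] carry the whole count of the pairs
    [(x, c)] with [c] in [BO i2] and [x] on both [c] and a chosen block of
    [BO i1].  With the orbits of length [1] listed first, [L = 1] and [L = w]
    select the columns of the two diagonal submatrices. *)
Lemma orbit_matrix_gram (L : nat) i1 i2 :
  #|BO i1| = L -> #|BO i2| = L ->
  (\sum_(j | #|VO j| == L)
      orbit_matrix inc BO VO i1 j * orbit_matrix inc BO VO i2 j
   = (i1 == i2) * k %[mod p])%N.
Proof.
move=> L1 L2.
have VOP j : VO j \in orbit_set (fst @* G)%G by rewrite -defV imset_f ?inE.
have BOP i : BO i \in orbit_set (snd @* G)%G by rewrite -defB imset_f ?inE.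
have rep i : exists b, b \in BO i.
  by have [b _ ->] := imsetP (BOP i); exists b; rewrite orbit_refl.
have [[b1 b1B] [b2 b2B]] := (rep i1, rep i2).
have omE := orbit_matrixE autG BOP VOP.
have -> : (i1 == i2) = (b1 \in BO i2).
  apply/eqP/idP => [<- // | b1B2]; apply: injB.
  exact: (orbit_set_eq (BOP i1) (BOP i2) b1B b1B2).
rewrite -sum_meet_mod -sum_points_through [in RHS]big_mkcond.
rewrite (big_orbit_ordering _ injV defV).
have split_col j : \sum_(x in VO j) (if x \in points_on inc b1
      then #|BO i2 :&: blocks_through inc x| else 0%N)
    = \sum_(x in VO j :&: points_on inc b1)
        #|BO i2 :&: blocks_through inc x|.
  by rewrite -big_mkcondr; apply: eq_bigl => x; rewrite [RHS]inE.
under [in RHS]eq_bigr do rewrite split_col.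
rewrite [in RHS](bigID (fun j => #|VO j| == L)) /= -modnDmr.
rewrite (_ : (\sum_(j | #|VO j| != L) _) %% p = 0)%N ?addn0.
  congr (_ %% _)%N; apply: eq_bigr => j /eqP Lj.
  rewrite (column_flags_eq _ (VOP j) (BOP i2) b2B) ?L2 //.
  by rewrite (omE _ _ _ b1B) (omE _ _ _ b2B).
apply/eqP; apply: dvdn_sum => j Lj.
apply: (column_flags_neq (VOP j) (BOP i1) b1B (BOP i2) b2B);
  rewrite ?L1 ?L2 //; first exact: lenV.
by rewrite -L2; exact: lenB.
Qed.

End Gram.

(** * Images of natural numbers in characteristic p *)

Section NaturalsInCharacteristic.
Local Open Scope ring_scope.

Lemma natr_eq_mod (R : nzRingType) (p x y : nat) : p \in [pchar R] ->
  (x%:R == y%:R :> R) = (x == y %[mod p]).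
Proof.
move=> pR; wlog le_yx : x y / (y <= x)%N.
  by case/orP: (leq_total y x) => le H; [exact: H | rewrite eq_sym H // eq_sym].
by rewrite eqn_mod_dvd // (dvdn_pcharf pR) natrB // subr_eq0.
Qed.

Lemma expr_natr_char_pow (R : nzRingType) (p l c : nat) : p \in [pchar R] ->
  (c%:R : R) ^+ (p ^ l) = c%:R.
Proof.
move=> pR; elim: l => [|l IHl]; first by rewrite expr1.
by rewrite expnSr exprM IHl -(pFrobenius_autE pR) pFrobenius_aut_nat.
Qed.

Lemma gram_natr (p k K N : nat) (F : finFieldType) (M : 'M[nat]_(K, N)) :
  p \in [pchar F] ->
  (forall i1 i2, (\sum_j M i1 j * M i2 j = (i1 == i2) * k %[mod p])%N) ->
  map_mx (fun x : nat => x%:R) M *m (map_mx (fun x : nat => x%:R) M)^T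
  = (k%:R)%:M :> 'M[F]_K.
Proof.
move=> pF gramM; apply/matrixP => i1 i2; rewrite !mxE.
have /eqP := gramM i1 i2; rewrite -(natr_eq_mod _ _ pF) natr_sum mulnC natrM.
by rewrite mulr_natr => /eqP <-; apply: eq_bigr => j _; rewrite !mxE natrM.
Qed.

End NaturalsInCharacteristic.

(** * Square roots in finite fields *)

Section SquareRoot.
Local Open Scope ring_scope.

(** In the cyclic group of units, of order [2e], the [e]-th power of [g ^+ i] is
    trivial for a generator [g] exactly when [i] is even. *)
Lemma euler_criterion (F : finFieldType) (e : nat) (c : F) :
  #|F| = e.*2.+1 -> c != 0 -> (exists x : F, x ^+ 2 = c) <-> c ^+ e = 1.
Proof.
move=> cardF c0; split=> [[x xc]|ce].
  have x0 : x != 0 by apply: contraNneq c0 => x0; rewrite -xc x0 expr0n.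
  rewrite -xc -exprM mul2n; apply: (mulfI x0).
  by rewrite -exprS -cardF expf_card mulr1.
have [u def_u] : exists u : {unit F}, val u = c.
  by have Uc : c \is a GRing.unit by [rewrite unitfE]; exists (Sub c Uc).
have e_gt0 : (0 < e)%N.
  by case: e cardF {ce} => // E; have := finRing_gt1 F; rewrite E.
have [g defg] := cyclicP (field_unit_group_cyclic [set: {unit F}]%G).
have ord_g : #[g]%g = e.*2 by rewrite orderE -defg card_finField_unit cardF.
have /cycleP[i def_i] : u \in <[g]>%g by rewrite -defg inE.
have : (g ^+ (i * e) == 1)%g.
  by rewrite expgM -def_i; apply/eqP/val_inj; rewrite FinRing.val_unitX def_u.
rewrite -order_dvdn ord_g -mul2n dvdn_pmul2r // => /dvdnP[h def_h].
exists (val (g ^+ h)%g).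
by rewrite -FinRing.val_unitX -expgM -def_h -def_i.
Qed.

Lemma sqrt_even_card (F : finFieldType) (c : F) : ~~ odd #|F| ->
  exists x : F, x ^+ 2 = c.
Proof.
move=> evenF; exists (c ^+ #|F|./2).
by rewrite -exprM muln2 even_halfK // expf_card.
Qed.

(** Euler's criterion for [c%:R] is a congruence modulo [p] with an exponent
    fixed by the order of the field, so it reads the same in [E] and in [F]. *)
Lemma square_natr_eq_card (p l c : nat) (E F : finFieldType) :
  prime p -> #|E| = (p ^ l)%N -> #|F| = (p ^ l)%N ->
  (exists x : E, x ^+ 2 = c%:R) -> exists y : F, y ^+ 2 = c%:R.
Proof.
move=> p_pr cardE cardF.
have [pE pF] := (card_finPcharP cardE p_pr, card_finPcharP cardF p_pr).
have [oddF | evenF] := boolP (odd #|F|); last first.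
  by move=> _; exact: sqrt_even_card.
have [cF0|c0] := eqVneq (c%:R : F) 0; first by exists 0; rewrite cF0 expr0n.
have cE0 : c%:R != 0 :> E by rewrite -(dvdn_pcharf pE) (dvdn_pcharf pF).
have odd_half (K : finFieldType) :
    #|K| = (p ^ l)%N -> #|K| = ((p ^ l)./2).*2.+1.
  by move=> ->; rewrite -{1}(odd_double_half (p ^ l)) -cardF oddF.
move=> /(euler_criterion (odd_half _ cardE) cE0) cE.
apply/(euler_criterion (odd_half _ cardF) c0)/eqP; move/eqP: cE.
by rewrite -!natrX -[1]/(1%:R) (natr_eq_mod _ _ pE) -(natr_eq_mod _ _ pF).
Qed.

(** The prime field consists of squares here: the Euler exponent
    [(q ^ 2 - 1) / 2] is [q - 1] times [(q + 1) / 2], and [c ^+ (q - 1) = 1]. *)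
Lemma square_natr_card_square (p l c : nat) (F : finFieldType) :
  prime p -> #|F| = ((p ^ l) ^ 2)%N ->
  exists y : F, y ^+ 2 = c%:R.
Proof.
move=> p_pr cardF.
have pF : p \in [pchar F].
  by apply: (@card_finPcharP _ _ (l * 2)); rewrite ?expnM.
have [oddF | evenF] := boolP (odd #|F|); last exact: sqrt_even_card.
have [cF0|c0] := eqVneq (c%:R : F) 0; first by exists 0; rewrite cF0 expr0n.
have := oddF; rewrite cardF oddX /= => oddq.
set h := (p ^ l)./2.
have def_q : (p ^ l = h.*2.+1)%N by rewrite -[LHS]odd_double_half oddq.
have card_h : #|F| = (h.*2 * h.+1).*2.+1 by rewrite cardF def_q; lia.
apply/(euler_criterion card_h c0); rewrite exprM.
suff -> : c%:R ^+ h.*2 = 1 :> F by rewrite expr1n.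
by apply: (mulfI c0); rewrite -exprS -def_q expr_natr_char_pow // mulr1.
Qed.

End SquareRoot.

(** * Codes spanned by bordered matrices *)

Section BorderedCode.
Local Open Scope ring_scope.
Variable F : finFieldType.

Lemma row_codeE (K N : nat) (M : 'M[F]_(K, N)) :
  row_code M = <<[tuple row i M | i < K]>>%VS.
Proof. by congr (<<_>>)%VS. Qed.

Lemma mem_row_code (K N : nat) (M : 'M[F]_(K, N)) (x : 'rV[F]_N) :
  reflect (exists z : 'rV_K, x = z *m M) (x \in row_code M).
Proof.
rewrite row_codeE; apply: (iffP idP) => [/coord_span ->|[z ->]].
  exists (\row_i coord [tuple row i M | i < K] i x).
  rewrite mulmx_sum_row; apply: eq_bigr => i _.
  by rewrite nth_mktuple mxE.
rewrite mulmx_sum_row; apply: rpred_sum => i _; apply/rpredZ/memv_span.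
by apply/tnthP; exists i; rewrite tnth_mktuple.
Qed.

Lemma dim_row_code (K N : nat) (M : 'M[F]_(K, N)) :
  row_free M -> \dim (row_code M) = K.
Proof.
move=> freeM; rewrite row_codeE -[RHS](size_tuple [tuple row i M | i < K]).
apply/eqP/freeP => c; under eq_bigr do rewrite nth_mktuple.
move=> c0 i; have : (\row_i c i) *m M = 0.
  by rewrite mulmx_sum_row -[RHS]c0; apply: eq_bigr => h _; rewrite mxE.
by move=> /eqP; rewrite mulmx_free_eq0 // => /eqP/rowP/(_ i); rewrite !mxE.
Qed.

Lemma dotpE (N : nat) (x y : 'rV[F]_N) : dotp x y = (x *m y^T) 0 0.
Proof. by rewrite mxE; apply: eq_bigr => i _; rewrite !mxE. Qed.

Lemma mem_dual_row_code (K N : nat) (M : 'M[F]_(K, N)) (y : 'rV[F]_N) :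
  (y \in dual_code (row_code M)) = (M *m y^T == 0).
Proof.
rewrite inE; apply/forallP/eqP => [yM | yM x].
  apply/matrixP => i j; rewrite (ord1 j) [RHS]mxE.
  have Mi : row i M \in row_code M.
    by apply/mem_row_code; exists (delta_mx 0 i); rewrite -rowE.
  have /eqP := implyP (yM (row i M)) Mi.
  by rewrite dotpE -row_mul mxE.
apply/implyP => /mem_row_code[z ->].
by rewrite dotpE -mulmxA yM mulmx0 mxE.
Qed.

Section Bordered.
Variables (K N : nat) (s : F) (M : 'M[nat]_(K, N)).
Let A : 'M[F]_(K, N) := map_mx (fun x : nat => x%:R) M.

Lemma dim_bordered_code : s != 0 -> \dim (row_code (bordered_mx s M)) = K.
Proof.
move=> s0; apply: dim_row_code; apply/row_freeP.
exists (col_mx (s^-1)%:M 0).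
by rewrite mul_row_col mulmx0 addr0 -scalar_mxM divff.
Qed.

Hypothesis gramA : A *m A^T = (- s ^+ 2)%:M.

(** The Gram matrix of the rows of [[s I, A]] is [s ^+ 2 I + A A^T = 0]. *)
Lemma self_orthogonal_bordered : self_orthogonal (row_code (bordered_mx s M)).
Proof.
move=> _ /mem_row_code[z ->]; rewrite mem_dual_row_code trmx_mul mulmxA.
rewrite tr_row_mx mul_row_col tr_scalar_mx -scalar_mxM gramA -expr2.
by rewrite -raddfD subrr raddf0 mul0mx.
Qed.

End Bordered.

(** For [(u, w)] in the dual, [s u = - w A^T]; as [A] is square, it commutes
    with [A^T] and [w = (s^-1 u) A] follows, so [(u, w) = (s^-1 u) [s I, A]]. *)
Lemma self_dual_bordered (K : nat) (s : F) (M : 'M[nat]_K) :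
  let A : 'M[F]_K := map_mx (fun x : nat => x%:R) M in
  s != 0 -> A *m A^T = (- s ^+ 2)%:M ->
  self_dual (row_code (bordered_mx s M)).
Proof.
move=> A s0 gramA y; apply/idP/idP; first exact: self_orthogonal_bordered.
rewrite mem_dual_row_code -[y]hsubmxK tr_row_mx mul_row_col.
set u := lsubmx y; set w := rsubmx y.
rewrite -/A mul_scalar_mx => /eqP dual_y.
have gramAT : A^T *m A = (- s ^+ 2)%:M.
  have s2 : - s ^+ 2 != 0 by rewrite oppr_eq0 expf_neq0.
  have /mulmx1C : A *m ((- s ^+ 2)^-1 *: A^T) = 1%:M.
    by rewrite -scalemxAr gramA scale_scalar_mx mulVf.
  rewrite -scalemxAl => /(congr1 ( *:%R (- s ^+ 2))).
  by rewrite scalerA divff // scale1r scale_scalar_mx mulr1.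
have def_u : s *: u = - (w *m A^T).
  apply: trmx_inj; rewrite linearZ linearN /= trmx_mul trmxK.
  by apply/eqP; rewrite -addr_eq0 dual_y.
apply/mem_row_code; exists (s^-1 *: u).
rewrite mul_mx_row mul_mx_scalar scalerA divff // scale1r; congr row_mx.
apply: (scalerI (expf_neq0 2 s0)).
rewrite -scalemxAl scalerA expr2 mulfK // scalemxAl def_u mulNmx -mulmxA gramAT.
by rewrite mul_mx_scalar scaleNr opprK -expr2.
Qed.

End BorderedCode.

(** * Codes from orbit matrices *)

Local Open Scope ring_scope.

Theorem theorem17
  (p l q : nat) (p_prime : prime p) (l_gt0 : (0 < l)%N) (q_def : q = (p ^ l)%N)
  (Fq : finFieldType) (card_Fq : #|Fq| = q)
  (point block : finType) (inc : point -> block -> bool)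
  (v k r : nat) (design : is_1_design inc v k r)
  (a : 'F_p) (a_neq0 : a != 0) (k_mod_p : k%:R = a)
  (meet_mod_p : forall B1 B2 : block, B1 != B2 ->
     #|points_on inc B1 :&: points_on inc B2| = 0 %[mod p])
  (G : {group {perm point} * {perm block}}) (autG : G \subset design_aut inc)
  (alpha : nat) (alpha_bounds : (1 <= alpha <= l)%N)
  (f1 n f2 m : nat)
  (point_orbits : orbit_type (fst @* G)%G f1 n (p ^ alpha))
  (block_orbits : orbit_type (snd @* G)%G f2 m (p ^ alpha))
  (VO : 'I_(f1 + n) -> {set point})
  (VO_ordering : orbit_ordering (fst @* G)%G VO)
  (BO : 'I_(f2 + m) -> {set block})
  (BO_ordering : orbit_ordering (snd @* G)%G BO)
  (F : finFieldType)
  (card_F : #|F| = if [exists x : Fq, x ^+ 2 == - Fp_in Fq a]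
                   then q else (q ^ 2)%N) :
  let OM1 : 'M[nat]_(f2, f1) := ulsubmx (orbit_matrix inc BO VO) in
  let OM2 : 'M[nat]_(m, n) := drsubmx (orbit_matrix inc BO VO) in
  (exists s : F, s ^+ 2 = - Fp_in F a) /\
  forall s : F, s ^+ 2 = - Fp_in F a ->
    let C1 : {vspace 'rV[F]_(f2 + f1)} := row_code (bordered_mx s OM1) in
    let C2 : {vspace 'rV[F]_(m + n)} := row_code (bordered_mx s OM2) in
    [/\ \dim C1 = f2, self_orthogonal C1,
        \dim C2 = m, self_orthogonal C2
      & m = n -> self_dual C2].
Proof.
move=> OM1 OM2.
have [_ block_size _] := design.
have [alpha_gt0 _] := andP alpha_bounds.
have [[_ _ lenV] [_ _ lenB]] := (point_orbits, block_orbits).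
have [[injV defV cardV] [injB defB cardB]] := (VO_ordering, BO_ordering).
have w_gt1 : (1 < p ^ alpha)%N by rewrite -(exp1n alpha) ltn_exp2r ?prime_gt1.
have dvd_pw : (p %| p ^ alpha)%N by rewrite dvdn_exp.
have pF : p \in [pchar F].
  move: card_F; rewrite q_def -expnM; case: ifP => _ /card_finPcharP; exact.
have aE (K : finFieldType) : p \in [pchar K] -> Fp_in K a = k%:R.
  move=> pK; apply/eqP; rewrite /Fp_in (natr_eq_mod _ _ pK) -k_mod_p.
  by rewrite val_Fp_nat // modn_mod.
have a0 : Fp_in F a != 0.
  rewrite aE // -(dvdn_pcharf pF); apply: contra a_neq0.
  by rewrite (dvdn_pcharf (pchar_Fp p_prime)) k_mod_p.
split.
  (* [- a] is the image of a natural number, as Euler's criterion for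
     fields of equal order requires *)
  have naE (K : finFieldType) : p \in [pchar K] -> - Fp_in K a = (k * p.-1)%:R.
    move=> pK; apply/eqP; rewrite aE // eq_sym -addr_eq0 -natrD.
    rewrite -mulnSr prednK ?prime_gt0 //.
    by rewrite -(dvdn_pcharf pK) dvdn_mull.
  have pFq : p \in [pchar Fq].
    by apply: (@card_finPcharP _ _ l); rewrite ?card_Fq.
  rewrite naE //; move: card_F; rewrite q_def.
  case: ifP => [/existsP[x /eqP xE] cardF | _].
    apply: (@square_natr_eq_card p l _ Fq) => //; first by rewrite card_Fq.
    by exists x; rewrite xE naE.
  exact: square_natr_card_square.
move=> s def_s C1 C2.
have s0 : s != 0.
  by apply: contra_eq_neq def_s => ->; rewrite expr0n eq_sym oppr_eq0.
have cardVl j : #|VO (lshift n j)| = 1%N.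
  by apply/eqP; rewrite cardV /=.
have cardVr j : #|VO (rshift f1 j)| = (p ^ alpha)%N.
  have := cardV (rshift f1 j); rewrite /= ltnNge leq_addr /= => /eqP.
  by case: (lenV (VO (rshift f1 j))); rewrite // -defV imset_f.
have cardBl i : #|BO (lshift m i)| = 1%N.
  by apply/eqP; rewrite cardB /=.
have cardBr i : #|BO (rshift f2 i)| = (p ^ alpha)%N.
  have := cardB (rshift f2 i); rewrite /= ltnNge leq_addr /= => /eqP.
  by case: (lenB (BO (rshift f2 i))); rewrite // -defB imset_f.
have gram := orbit_matrix_gram autG dvd_pw block_size meet_mod_p
  injV defV injB defB lenV lenB.
have gram1 : map_mx (fun x : nat => x%:R) OM1
    *m (map_mx (fun x : nat => x%:R) OM1)^T = (- s ^+ 2)%:M :> 'M[F]_f2.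
  rewrite def_s opprK aE //; apply: (gram_natr pF) => i1 i2.
  rewrite -(eq_lshift m) -(gram 1%N) // big_split_ord /=.
  rewrite [X in (_ + X)%N]big_pred0 ?addn0 => [|j]; last first.
    by rewrite cardVr gtn_eqF.
  congr (_ %% _)%N; apply: eq_big => j; first by rewrite cardVl.
  by rewrite /OM1 ![ulsubmx _ _ _]mxE ![usubmx _ _ _]mxE.
have gram2 : map_mx (fun x : nat => x%:R) OM2
    *m (map_mx (fun x : nat => x%:R) OM2)^T = (- s ^+ 2)%:M :> 'M[F]_m.
  rewrite def_s opprK aE //; apply: (gram_natr pF) => i1 i2.
  rewrite -(eq_rshift f2) -(gram (p ^ alpha)%N) // big_split_ord /=.
  rewrite [X in (X + _)%N]big_pred0 ?add0n => [|j]; last first.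
    by rewrite cardVl ltn_eqF.
  congr (_ %% _)%N; apply: eq_big => j; first by rewrite cardVr eqxx.
  by rewrite /OM2 ![drsubmx _ _ _]mxE ![dsubmx _ _ _]mxE.
split; [exact: dim_bordered_code | exact: self_orthogonal_bordered |
  exact: dim_bordered_code | exact: self_orthogonal_bordered |].
rewrite /C2 => emn; move: (OM2) gram2; rewrite -emn => M gramM.
exact: self_dual_bordered.
Qed.
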